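(* Let $(M,\widetilde B)$ be a strict root of unity quantum seed with respect to a skew-symmetric integer matrix $\Lambda$, $(M_q,\widetilde B)$ the associated quantum seed, and $\mathrm{inv}\subseteq[1,N]\setminus\mathrm{ex}$. If $$\mathcal A_q(M_q,\widetilde B,\mathrm{inv})\cap\big(\Phi_\ell(q^{1/2})\,\mathcal T_q(M_q)_\ge\big)=\Phi_\ell(q^{1/2})\,\mathcal A_q(M_q,\widetilde B,\mathrm{inv}),$$ then $\mathcal A_q(M_q,\widetilde B,\mathrm{inv})/(\Phi_\ell(q^{1/2}))\cong\mathcal A_\varepsilon(M,\widetilde B,\mathrm{inv})$, and the specialization map $\eta_\varepsilon:\mathcal A_q(M_q,\widetilde B,\mathrm{inv})\to\mathcal A_q(M_q,\widetilde B,\mathrm{inv})/(\Phi_\ell(q^{1/2}))$ is the restriction to $\mathcal A_q(M_q,\widetilde B,\mathrm{inv})$ of the specialization map $\kappa_\varepsilon:\mathcal T_q(M_q)_\ge\to\mathcal T_\varepsilon(M)_\ge$.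
   Context: Root of unity setting: $\ell$ a positive integer, $\mathbb Z_\ell=\mathbb Z/\ell\mathbb Z$, $\varepsilon^{1/2}\in\mathbb C$ a primitive $\ell$-th root of unity, $\mathcal A^{1/2}_\varepsilon=\mathbb Z[\varepsilon^{1/2}]$, $\varepsilon^{a/2}=(\varepsilon^{1/2})^a$; $\overline C$ = reduction mod $\ell$; $e_1,\dots,e_N$ standard basis. For skew-symmetric $\Lambda:\mathbb Z^N\times\mathbb Z^N\to\mathbb Z_\ell$, $\mathcal T_\varepsilon(\Lambda)$ has $\mathcal A^{1/2}_\varepsilon$-basis $X^f$ with $X^fX^g=\varepsilon^{\Lambda(f,g)/2}X^{f+g}$; a root of unity toric frame of a division algebra $\mathcal F$ over $\mathbb Q(\varepsilon^{1/2})$ is $M:\mathbb Z^N\to\mathcal F$ with $f\mapsto M(f)$ extending to an injective algebra map from some (unique) $\mathcal T_\varepsilon(\Lambda_M)$ whose image $\mathcal T_\varepsilon(M)$ generates $\mathcal F$ as a skew field. Fix $\mathrm{ex}\subseteq[1,N]$; $\widetilde B=(b_{ij})$ integer, rows $[1,N]$, columns $\mathrm{ex}$, principal part $B$, columns $b^k$. $\ell$-compatibility w.r.t. $D=\mathrm{diag}(d_j)_{j\in\mathrm{ex}}$ ($d_j>0$): $DB$ skew-symmetric and $\sum_k\overline b_{kj}(\Lambda_M)_{ki}=\delta_{ij}\overline d_j$ mod $\ell$; seeds are such pairs $(M,\widetilde B)$; mutation $\mu_k$: $\mu_k(\widetilde B)$ has entries $-b_{ij}$ if $i=k$ or $j=k$,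 else $b_{ij}+(|b_{ik}|b_{kj}+b_{ik}|b_{kj}|)/2$; $\mu_k(M)$ is the frame with matrix $\overline E^\top\Lambda_M\overline E$ ($e_{ij}=\delta_{ij}$ for $j\ne k$, $e_{kk}=-1$, $e_{ik}=\max(0,-b_{ik})$), $\mu_k(M)(e_j)=M(e_j)$ ($j\neq k$), $\mu_k(M)(e_k)=M(-e_k+[b^k]_+)+M(-e_k-[b^k]_-)$ ($[b]_\pm$ keeps entries with $\pm b_i\ge0$). $\mathcal A_\varepsilon(M,\widetilde B,\mathrm{inv})$ is the $\mathcal A^{1/2}_\varepsilon$-algebra generated by cluster variables $M'(e_i)$ of all mutation-equivalent seeds and $M(e_j)^{-1}$, $j\in\mathrm{inv}$. Quantum setting: $\mathcal A^{1/2}_q=\mathbb Z[q^{\pm1/2}]$; $\mathcal T_q(\Lambda)$ for skew-symmetric integer $\Lambda$ has basis $X^f$ with $X^fX^g=q^{\Lambda(f,g)/2}X^{f+g}$; toric frames $M_q$, compatibility ($\sum_kb_{kj}\lambda_{ki}=\delta_{ij}d_j$), quantum seeds, mutations and $\mathcal A_q(M_q,\widetilde B,\mathrm{inv})$ are defined analogously over $\mathcal A^{1/2}_q$. Mixed tori: $\mathcal T_q(M_q)_\ge$ (resp. $\mathcal T_\varepsilon(M)_\ge$) is the subalgebra generated by $M_q(e_i)$, $i\in[1,N]$, and $M_q(e_j)^{-1}$, $j\in\mathrm{ex}\sqcup\mathrm{inv}$ (resp. same with $M$). Strictness: $(M,\widetilde B)$ is strict w.r.t. skew-symmetric $\Lambda\in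 M_N(\mathbb Z)$ if $\overline\Lambda=\Lambda_M$ and $(\Lambda,\widetilde B)$ is compatible w.r.t. the same $D$; the associated quantum seed is $(M_q,\widetilde B)$ in $\mathrm{Fract}(\mathcal T_q(\Lambda))$ with $M_q(f)=X^f$. $\Phi_\ell$ is the $\ell$-th cyclotomic polynomial; $\kappa_\varepsilon:\mathcal T_q(M_q)\to\mathcal T_\varepsilon(M)$ is the ring surjection with $q^{1/2}\mapsto\varepsilon^{1/2}$, $M_q(f)\mapsto M(f)$, with kernel $(\Phi_\ell(q^{1/2}))$; it restricts to $\kappa_\varepsilon:\mathcal T_q(M_q)_\ge\to\mathcal T_\varepsilon(M)_\ge\cong\mathcal T_q(M_q)_\ge/(\Phi_\ell(q^{1/2}))$. By the quantum Laurent phenomenon $\mathcal A_q(M_q,\widetilde B,\mathrm{inv})\subseteq\mathcal T_q(M_q)_\ge$. *)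

(* Defs.v *)
From HB Require Import structures.
From mathcomp Require Import all_boot all_order all_algebra all_field.
Set Implicit Arguments. Unset Strict Implicit. Unset Printing Implicit Defensive.
Import Order.TTheory GRing.Theory Num.Theory.
Local Open Scope ring_scope.

Definition pev (R : unitRingType) (p : {poly int}) (x : R) : R :=
  \sum_(i < size p) (p`_i)%:~R * x ^+ i.

Inductive subring_gen (R : unitRingType) (S : R -> Prop) : R -> Prop :=
| sg_base x : S x -> subring_gen S x
| sg_one : subring_gen S 1
| sg_add x y : subring_gen S x -> subring_gen S y -> subring_gen S (x + y)
| sg_opp x : subring_gen S x -> subring_gen S (- x)
| sg_mul x y : subring_gen S x -> subring_gen S y -> subring_gen S (x * y).

Inductive divring_gen (R : unitRingType) (S : R -> Prop) : R -> Prop :=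
| dg_base x : S x -> divring_gen S x
| dg_one : divring_gen S 1
| dg_add x y : divring_gen S x -> divring_gen S y -> divring_gen S (x + y)
| dg_opp x : divring_gen S x -> divring_gen S (- x)
| dg_mul x y : divring_gen S x -> divring_gen S y -> divring_gen S (x * y)
| dg_inv x : x != 0 -> divring_gen S x -> divring_gen S x^-1.

Definition is_divring (R : unitRingType) := forall x : R, x != 0 -> x \is a GRing.unit.

Section ClusterDefs.
Variable N : nat.
Local Notation vec := 'cV[int]_N.

Definition evec (i : 'I_N) : vec := delta_mx i 0.

Definition bform (L : 'M[int]_N) (f g : vec) : int := (f^T *m L *m g) 0 0.

Definition pospart (b : vec) : vec := \col_i Num.max (b i 0) 0.
Definition negpart (b : vec) : vec := \col_i Num.min (b i 0) 0.

(* matrix mutation mu_k(Btil); Btil is stored as an N x N matrix whose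
   columns outside ex are never used *)
Definition mutB (k : 'I_N) (B : 'M[int]_N) : 'M[int]_N :=
  \matrix_(i, j) if (i == k) || (j == k) then - B i j
     else B i j + ((`|B i k| * B k j + B i k * `|B k j|) %/ 2)%Z.

Definition mutE (k : 'I_N) (B : 'M[int]_N) : 'M[int]_N :=
  \matrix_(i, j) if j == k then (if i == k then -1 else Num.max 0 (- B i k))
                 else (i == j)%:R.

Definition mutL (k : 'I_N) (B L : 'M[int]_N) : 'M[int]_N :=
  (mutE k B)^T *m L *m mutE k B.

Variable R : unitRingType.

(* the toric frame with matrix L (scalar s = image of q^{1/2}, resp. eps^{1/2})
   whose values on the basis vectors are v :
   M(f) = s^{-sum_{i<j} f_i f_j L_ij} v_1^{f_1} ... v_N^{f_N} *)
Definition frame_of (s : R) (L : 'M[int]_N) (v : 'I_N -> R) (f : vec) : R :=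
  s ^ (- \sum_(i < N) \sum_(j < N | (i < j)%N) f i 0 * f j 0 * L i j)
    * \prod_(i < N) v i ^ (f i 0).

(* a seed: matrix of the frame, exchange matrix, values M(e_i) *)
Record seedT := Seed { sL : 'M[int]_N; sB : 'M[int]_N; sv : 'I_N -> R }.

Definition mut_seed (s : R) (k : 'I_N) (S : seedT) : seedT :=
  let L := sL S in let B := sB S in let v := sv S in
  Seed (mutL k B L) (mutB k B)
   (fun j => if j == k then frame_of s L v (- evec k + pospart (col k B))
                          + frame_of s L v (- evec k - negpart (col k B))
             else v j).

Definition mut_seq (s : R) (ks : seq 'I_N) (S : seedT) : seedT :=
  foldl (fun S' k => mut_seed s k S') S ks.

Definition cluster_var (s : R) (ex : {set 'I_N}) (S : seedT) (x : R) : Prop :=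
  exists ks : seq 'I_N, all (fun k => k \in ex) ks /\
    exists i, x = sv (mut_seq s ks S) i.

(* the cluster algebra: scal describes generators of the base ring *)
Definition clusterAlg (scal : R -> Prop) (s : R) (ex inv : {set 'I_N})
  (S : seedT) : R -> Prop :=
  subring_gen (fun x => scal x \/ cluster_var s ex S x \/
                        exists j, j \in inv /\ x = (sv S j)^-1).

Definition mixedTorus (scal : R -> Prop) (ex inv : {set 'I_N})
  (M : vec -> R) : R -> Prop :=
  subring_gen (fun x => scal x \/ (exists i, x = M (evec i)) \/
                        exists j, ((j \in ex) || (j \in inv)) /\ x = (M (evec j))^-1).

Definition frame_rel (s : R) (L : 'M[int]_N) (M : vec -> R) : Prop :=
  M 0 = 1 /\ forall f g, M f * M g = s ^ (bform L f g) * M (f + g).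

(* quantum toric frame: injectivity of T_q(L) -> R, coefficients in
   Z[q^{+-1/2}] written p(t) t^{-k} *)
Definition q_toric_frame (t : R) (L : 'M[int]_N) (M : vec -> R) : Prop :=
  frame_rel t L M /\
  (forall c : seq (vec * ({poly int} * nat)), uniq (map fst c) ->
     \sum_(a <- c) (pev a.2.1 t * t ^- a.2.2) * M a.1 = 0 ->
     forall a, a \in c -> a.2.1 = 0) /\
  (forall x, divring_gen (fun y => y = t \/ exists f, y = M f) x).

(* root of unity toric frame with matrix L mod ell: injectivity of
   T_eps(L) -> R, coefficients in Z[eps^{1/2}] = Z[e] written p(e) *)
Definition ru_toric_frame (e : R) (L : 'M[int]_N) (M : vec -> R) : Prop :=
  frame_rel e L M /\
  (forall c : seq (vec * {poly int}), uniq (map fst c) ->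
     \sum_(a <- c) pev a.2 e * M a.1 = 0 ->
     forall a, a \in c -> pev a.2 e = 0) /\
  (forall x, divring_gen (fun y => y = e \/ exists f, y = M f) x).

End ClusterDefs.

(* specialization map kappa_eps, as a relation (it is well defined on
   T_q(M_q) by injectivity of the quantum toric frame) *)
Definition kappa (N : nat) (D F : unitRingType) (t : D) (X : 'cV[int]_N -> D)
  (e : F) (M : 'cV[int]_N -> F) (x : D) (y : F) : Prop :=
  exists c : seq ('cV[int]_N * ({poly int} * nat)),
    x = \sum_(a <- c) (pev a.2.1 t * t ^- a.2.2) * X a.1 /\
    y = \sum_(a <- c) (pev a.2.1 e * e ^- a.2.2) * M a.1.

(* Main.v *)
Require Import Defs.
From HB Require Import structures.
From mathcomp Require Import all_boot all_order all_algebra all_field.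
From mathcomp Require Import zify ring.
Import Order.TTheory GRing.Theory Num.Theory.
Local Open Scope ring_scope.

(* The inclusion Phi A_q <= Phi T_>= contained in the hypothesis already gives
   A_q <= T_>=, since D has no zero divisors; so kappa is defined on A_q without
   appeal to the quantum Laurent phenomenon.

   The map kappa sends quantum cluster variables to the corresponding cluster
   variables by induction along a sequence of mutations: both sides satisfy the
   same exchange relation v_k v'_k = P(v), and v_k can be cancelled in F. For
   this the cluster variables in F must be nonzero, which is not automatic at a
   root of unity; it follows because mutation preserves the linear independence
   of the monomials of a frame. Hence kappa maps A_q onto A_eps.

   If kappa x = 0, the coefficients of x vanish at eps, so they are divisible by
   the cyclotomic polynomial and x is in Phi T_>=; the hypothesis then puts x in
   Phi A_q. *)

Set Implicit Arguments.
Unset Strict Implicit.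
Unset Printing Implicit Defensive.

Definition central (R : unitRingType) (s : R) := forall x : R, s * x = x * s.

(** * Evaluation of integer polynomials at a ring element *)

Section Evaluation.
Variables (R : unitRingType) (s : R).

Lemma pevE (p : {poly int}) : pev p s = (map_poly intr p).[s].
Proof.
rewrite (@horner_coef_wide _ (size p)) ?size_poly //.
by apply: eq_bigr => i _; rewrite coef_map.
Qed.

Let comm_intr : commr_rmorph (intr : int -> R) s.
Proof. by move=> n; apply: commr_int. Qed.

Lemma pevD p q : pev (p + q) s = pev p s + pev q s.
Proof. by rewrite !pevE -!/(horner_morph comm_intr _) rmorphD. Qed.

Lemma pevN p : pev (- p) s = - pev p s.
Proof. by rewrite !pevE -!/(horner_morph comm_intr _) rmorphN. Qed.

Lemma pevM p q : pev (p * q) s = pev p s * pev q s.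
Proof. by rewrite !pevE -!/(horner_morph comm_intr _) rmorphM. Qed.

Lemma pev0 : pev 0 s = 0.
Proof. by rewrite pevE -/(horner_morph comm_intr _) rmorph0. Qed.

Lemma pevC n : pev n%:P s = n%:~R.
Proof. by rewrite pevE map_polyC hornerC. Qed.

Lemma pevXn n : pev 'X^n s = s ^+ n.
Proof. by rewrite pevE map_polyXn hornerXn. Qed.

Lemma pev1 : pev 1 s = 1.
Proof. by rewrite (pevC 1). Qed.

End Evaluation.

(** * Integer polynomials vanishing at a root of the cyclotomic polynomial *)

Section Cyclotomic.

Lemma Cyclotomic_dvd_Xn_sub_1 n : (0 < n)%N -> exists q, q * 'Phi_n = 'X^n - 1.
Proof.
move=> n0; rewrite -(prod_Cyclotomic n0).
have nn : n \in divisors n by rewrite -dvdn_divisors.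
exists (\prod_(d <- rem n (divisors n)) 'Phi_d).
by rewrite (perm_big _ (perm_to_rem nn)) big_cons mulrC.
Qed.

Lemma Cyclotomic_root_expr1 (R : unitRingType) (x : R) n :
  (0 < n)%N -> pev 'Phi_n x = 0 -> x ^+ n = 1.
Proof.
move=> n0 x0; have [q qE] := Cyclotomic_dvd_Xn_sub_1 n0.
apply/eqP; rewrite -subr_eq0; apply/eqP.
by rewrite -(pevXn x n) -(pev1 x) -pevN -pevD -qE pevM x0 mulr0.
Qed.

(** Over the rationals ['Phi_n] is the minimal polynomial of a primitive root of unity, hence
    irreducible. Divisibility descends to the integers because ['Phi_n] is monic, and a rational
    Bezout relation becomes integral after clearing denominators. *)
Lemma dvdp_or_coprime_Cyclotomic n (p : {poly int}) : (0 < n)%N ->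
  (exists q, p = 'Phi_n * q) \/
  exists u v m, m != 0 /\ u * p + v * 'Phi_n = m%:P.
Proof.
move=> n0; have [z zP] := C_prim_root_exists n0.
pose ZQ : {poly int} -> {poly rat} := map_poly intr.
have [f [fE fm] fP] := minCpolyP z.
have fPhi : f = ZQ 'Phi_n.
  apply: (map_poly_inj (@ratr algC)); rewrite -fE (minCpoly_cyclotomic zP).
  rewrite -(Cintr_Cyclotomic zP) -map_poly_comp; apply: eq_map_poly => i /=.
  by rewrite ratr_int.
have [cop|ncop] := boolP (coprimep (ZQ p) (ZQ 'Phi_n)); last first.
  left; have: f %| ZQ p.
    move: ncop; rewrite /coprimep.
    have := dvdp_gcdl (ZQ p) (ZQ 'Phi_n).
    have /dvdpP[h] := dvdp_gcdr (ZQ p) (ZQ 'Phi_n).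
    rewrite -fPhi; move: (gcdp _ _) => g hE gp ncop.
    have f0 : f != 0 by rewrite monic_neq0.
    have [h0 g0] : h != 0 /\ g != 0 by apply/andP; rewrite -negb_or -mulf_eq0 -hE.
    (* As [f = h * g], the root [z] belongs to [h] or to [g]. In the first case [f] divides [h], so
       [g] is constant, against [ncop]; in the second [f] divides [g], which divides [p]. *)
    have: root (map_poly ratr f) z by rewrite fP.
    rewrite {1}hE rmorphM rootM !fP => /orP[fh|]; last first.
      by move=> /dvdp_trans; apply.
    case/negP: ncop; have := dvdp_leq h0 fh; rewrite hE size_mul //.
    rewrite -!size_poly_gt0 in h0 g0 *; rewrite eqn_leq g0 andbT.
    by case: (size g) g0 => // m _; rewrite addnS /= -{2}[size h]addn0 leq_add2l.
  rewrite fPhi dvdp_rat_int => /(Pdiv.IdomainMonic.dvdpP (Cyclotomic_monic n))[q ->].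
  by exists q; rewrite mulrC.
right; case/Bezout_eq1_coprimepP: cop => -[u v] /= uv.
have [u' [a a0 uE]] := rat_poly_scale u.
have [v' [b b0 vE]] := rat_poly_scale v.
exists (b%:P * u'), (a%:P * v'), (a * b); split; first by rewrite mulf_neq0.
apply: (@map_inj_poly _ _ (intr : int -> rat)) => //; first exact: intr_inj.
rewrite rmorphD !rmorphM /= !map_polyC /=.
have a0' : a%:~R != 0 :> rat by rewrite intr_eq0.
have b0' : b%:~R != 0 :> rat by rewrite intr_eq0.
have -> : map_poly intr u' = (a%:~R)%:P * u.
  by rewrite uE mul_polyC scalerA divff // scale1r.
have -> : map_poly intr v' = (b%:~R)%:P * v.
  by rewrite vE mul_polyC scalerA divff // scale1r.
transitivity (a%:~R%:P * b%:~R%:P * (u * ZQ p + v * ZQ 'Phi_n)); last by rewrite uv mulr1.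
ring.
Qed.

(** In the coprime case, evaluating the Bezout relation at [x] makes a nonzero integer vanish in
    [R]. *)
Lemma Cyclotomic_dvd_of_root (R : unitRingType) (x : R) n (p : {poly int}) :
    (0 < n)%N -> (forall m, (0 < m)%N -> m%:R != 0 :> R) ->
    pev 'Phi_n x = 0 -> pev p x = 0 ->
  exists q, p = 'Phi_n * q.
Proof.
move=> n0 char0 Phi0 p0; case: (dvdp_or_coprime_Cyclotomic p n0) => // -[u [v [m [m0 E]]]].
have: pev (u * p + v * 'Phi_n) x = 0 by rewrite pevD !pevM p0 Phi0 !mulr0 addr0.
rewrite E pevC => mR; exfalso.
have : (`|m|%N)%:R != 0 :> R by apply: char0; lia.
case: (intP m) mR m0 => [|k|k] //; rewrite ?abszN ?absz_nat.
- by rewrite -pmulrn => ->; rewrite eqxx.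
- by move/eqP; rewrite mulrNz oppr_eq0 -pmulrn => /eqP ->; rewrite eqxx.
Qed.

End Cyclotomic.

(** * Commutation up to powers of a central unit *)

Section Commutation.
Variables (R : unitRingType) (s : R).
Hypotheses (cs : central s) (us : s \is a GRing.unit).

Lemma centralV : central s^-1.
Proof. by move=> x; apply/esym/commrV/esym/cs. Qed.

Lemma centralX n : central (s ^+ n).
Proof. by move=> x; apply/esym/commrX/esym/cs. Qed.

Lemma centralXz n : central (s ^ n).
Proof. by move=> x; apply/esym/commrXz/esym/cs. Qed.

Lemma mulXzA m n x : s ^ m * (s ^ n * x) = s ^ (m + n) * x.
Proof. by rewrite mulrA -exprzDr. Qed.

Lemma mulrXzCA n x y : x * (s ^ n * y) = s ^ n * (x * y).
Proof. by rewrite mulrA -centralXz mulrA. Qed.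

Lemma qcommXz (x y : R) (n m : int) : x \is a GRing.unit ->
  x * y = s ^ n * (y * x) -> x ^ m * y = s ^ (m * n) * (y * x ^ m).
Proof.
move=> ux xy.
have nat_case k : x ^+ k * y = s ^ (k%:Z * n) * (y * x ^+ k).
  elim: k => [|k IHk]; first by rewrite !expr0 mul0r expr0z !mul1r mulr1.
  rewrite exprSr -mulrA xy mulrXzCA (mulrA (x ^+ k)) IHk -[in RHS]exprSr.
  by rewrite exprSr !mulrA -exprzDr //; congr (s ^ _ * _ * _ * _); lia.
case: (intP m) => [|k|k]; first exact: (nat_case 0%N).
  exact: nat_case.
have uk : x ^+ k.+1 \is a GRing.unit by rewrite unitrX.
rewrite -exprnN; apply: (mulrI uk); rewrite mulrA divrr // mul1r.
rewrite mulrXzCA (mulrA (x ^+ _)) nat_case -mulrA mulrK // mulXzA.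
by rewrite (_ : _ + _ = 0) ?expr0z ?mul1r //; lia.
Qed.

End Commutation.

(** * Values of integer Laurent polynomials at a central unit *)

Section Scalars.
Variables (R : unitRingType) (s : R).
Hypotheses (cs : central s) (us : s \is a GRing.unit).

Definition lcoef (u : R) := exists p k, u = pev p s * s ^- k.

Lemma pev_central p : central (pev p s).
Proof.
move=> x; rewrite /pev mulr_suml mulr_sumr; apply: eq_bigr => i _.
by rewrite mulrA commr_int -!mulrA centralX.
Qed.

Lemma lcoef_central u : lcoef u -> central u.
Proof.
move=> [p [k ->]] x.
by rewrite -mulrA (centralV (centralX cs k)) mulrA pev_central mulrA.
Qed.

Lemma lcoefXz n : lcoef (s ^ n).
Proof.
case: (intP n) => [|k|k].
- by exists 1, 0%N; rewrite pev1 invr1 mulr1.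
- by exists 'X^(k.+1), 0%N; rewrite pevXn invr1 mulr1.
- by exists 1, k.+1; rewrite pev1 mul1r exprnN.
Qed.

Lemma lcoef1 : lcoef 1.
Proof. exact: (lcoefXz 0). Qed.

Lemma lcoef0 : lcoef 0.
Proof. by exists 0, 0%N; rewrite pev0 mul0r. Qed.

Lemma lcoefD u v : lcoef u -> lcoef v -> lcoef (u + v).
Proof.
move=> [p [k ->]] [q [l ->]]; exists (p * 'X^l + q * 'X^k), (k + l)%N.
rewrite pevD !pevM !pevXn mulrDl -!mulrA; congr (_ * _ + _ * _).
  by rewrite addnC exprD invrM ?unitrX // mulrA centralX // mulrK ?unitrX.
by rewrite exprD invrM ?unitrX // mulrA centralX // mulrK ?unitrX.
Qed.

Lemma lcoefN u : lcoef u -> lcoef (- u).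
Proof. by move=> [p [k ->]]; exists (- p), k; rewrite pevN mulNr. Qed.

Lemma lcoefM u v : lcoef u -> lcoef v -> lcoef (u * v).
Proof.
move=> [p [k ->]] [q [l ->]]; exists (p * q), (l + k)%N.
rewrite pevM exprD invrM ?unitrX // -!mulrA; congr (_ * _).
by rewrite !mulrA (centralV (centralX cs k)).
Qed.

End Scalars.

(** * Spans and linear independence of monomials *)

Section Span.
Variables (N : nat) (R : unitRingType) (s : R).
Hypotheses (cs : central s) (us : s \is a GRing.unit).
Local Notation vec := 'cV[int]_N.
Implicit Types (M : vec -> R) (P Q : vec -> Prop).

(** The predicate [P] keeps track of the exponents that occur: a fixed degree in one direction for
    mutations, a cone for mixed tori. *)
Inductive lspan M P : R -> Prop :=
| lspan0 : lspan M P 0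
| lspan_cons c f x : lcoef s c -> P f -> lspan M P x -> lspan M P (c * M f + x).

Lemma lspan_term M P c f : lcoef s c -> P f -> lspan M P (c * M f).
Proof. by move=> ? ?; rewrite -[_ * _]addr0; apply: lspan_cons => //; apply: lspan0. Qed.

Lemma lspan_gen M P f : P f -> lspan M P (M f).
Proof. by move=> Pf; rewrite -[M f]mul1r; apply: lspan_term => //; apply: lcoef1. Qed.

Lemma lspanD M P x y : lspan M P x -> lspan M P y -> lspan M P (x + y).
Proof.
by move=> sx sy; elim: sx => [|c f z ? ? _ ?]; rewrite ?add0r // -addrA; constructor.
Qed.

Lemma lspanZ M P c x : lcoef s c -> lspan M P x -> lspan M P (c * x).
Proof.
move=> cc; elim=> [|c' f z ? ? _ ?]; rewrite ?mulr0; first by constructor.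
by rewrite mulrDr mulrA; constructor => //; apply: lcoefM.
Qed.

Lemma lspanN M P x : lspan M P x -> lspan M P (- x).
Proof. by rewrite -mulN1r; apply: lspanZ; apply/lcoefN/lcoef1. Qed.

Lemma lspanW M P Q x : (forall f, P f -> Q f) -> lspan M P x -> lspan M Q x.
Proof. by move=> PQ; elim=> [|*]; constructor => //; apply: PQ. Qed.

Lemma lspan_sum M P (I : eqType) (r : seq I) (F : I -> R) :
  (forall i, i \in r -> lspan M P (F i)) -> lspan M P (\sum_(i <- r) F i).
Proof.
elim: r => [|i r IHr] Fr; rewrite ?big_nil ?big_cons; first by constructor.
apply: lspanD; first by apply: Fr; rewrite mem_head.
by apply: IHr => j rj; apply: Fr; rewrite inE rj orbT.
Qed.

Lemma lspanM (L : 'M[int]_N) M P Q T x y : frame_rel s L M ->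
    (forall f g, P f -> Q g -> T (f + g)) ->
  lspan M P x -> lspan M Q y -> lspan M T (x * y).
Proof.
move=> [_ MM] PQT sx sy; elim: sx => [|c f z cc Pf _ IHz]; rewrite ?mul0r ?mulrDl.
  by constructor.
apply: lspanD => //; rewrite -mulrA; apply: lspanZ => //.
elim: sy => [|c' g w cc' Qg _ IHw]; rewrite ?mulr0 ?mulrDr; first by constructor.
apply: lspanD => //; rewrite mulrA -(lcoef_central cs cc') -mulrA MM.
apply: lspanZ => //; apply: lspan_term; last exact: PQT.
exact: lcoefXz.
Qed.

Lemma big_restrict (A B : seq vec) (c : vec -> R) : uniq A -> uniq B ->
    {subset A <= B} ->
  \sum_(f <- B) (if f \in A then c f else 0) = \sum_(f <- A) c f.
Proof.
move=> uA uB AB; rewrite -big_mkcond -big_filter; apply: perm_big.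
apply: uniq_perm; rewrite ?filter_uniq // => f.
by rewrite mem_filter andb_idr // => /AB.
Qed.

(** Collects like terms, giving the repetition-free form on which [indep] acts. *)
Lemma lspan_rep M P x : lspan M P x ->
  exists (S : seq vec) (c : vec -> R),
  [/\ uniq S, forall f, lcoef s (c f), forall f, f \in S -> P f
    & x = \sum_(f <- S) c f * M f].
Proof.
elim=> [|c f z cc Pf _ [S [c' [uS cc' PS ->]]]].
  by exists [::], (fun=> 0); split => // [_|]; [apply: lcoef0|rewrite big_nil].
pose T := undup (f :: S).
exists T, (fun g => (if g \in [:: f] then c else 0) + (if g \in S then c' g else 0)).
split; first exact: undup_uniq.
- by move=> g; apply: lcoefD => //; case: ifP => // _; apply: lcoef0.
- by move=> g; rewrite mem_undup inE => /orP[/eqP-> //|]; apply: PS.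
have sub1 : {subset [:: f] <= T}.
  by move=> g; rewrite mem_undup !inE => ->.
have sub2 : {subset S <= T}.
  by move=> g; rewrite mem_undup !inE => ->; rewrite orbT.
rewrite [RHS](eq_bigr _ (fun g _ => mulrDl _ _ _)) big_split /=; congr (_ + _).
  rewrite -[LHS](big_seq1 +%R f (fun g => c * M g)).
  rewrite -(big_restrict _ _ _ sub1) ?undup_uniq //.
  by apply: eq_bigr => g _; case: ifP; rewrite ?mul0r.
rewrite -(big_restrict _ _ _ sub2) ?undup_uniq //.
by apply: eq_bigr => g _; case: ifP; rewrite ?mul0r.
Qed.

Definition indep M := forall (S : seq vec) (c : vec -> R),
  uniq S -> (forall f, lcoef s (c f)) -> \sum_(f <- S) c f * M f = 0 ->
  forall f, f \in S -> c f = 0.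

(** The two supports are disjoint, so the coefficients of [x] and [y] glue into a single relation,
    which is trivial by independence. *)
Lemma indep_lspan_disjoint M P x y : indep M ->
    lspan M P x -> lspan M (fun f => ~ P f) y -> x + y = 0 -> x = 0.
Proof.
move=> iM /lspan_rep[S [c [uS cc PS ->]]] /lspan_rep[T [b [uT cb PT ->]]] xy.
have disj f : f \in S -> f \in T = false by move=> /PS Pf; apply/negP => /PT.
rewrite big_seq big1 // => f fS.
suff -> : c f = 0 by rewrite mul0r.
have := iM (S ++ T) (fun f => if f \in S then c f else b f).
move=> /(_ _ _ _ f); rewrite mem_cat fS; apply=> //.
- rewrite cat_uniq uS uT andbT /=; apply/hasPn => g gT.
  by apply/negP => /disj; rewrite gT.
- by move=> g; case: ifP.
rewrite big_cat /= -[RHS]xy; congr (_ + _); rewrite big_seq [RHS]big_seq.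
  by apply: eq_bigr => g ->.
by apply: eq_bigr => g /= gT; case: ifP => // /disj; rewrite gT.
Qed.

Lemma indep_neq M f g : indep M -> f != g -> M f + M g != 0.
Proof.
move=> iM fg; apply/eqP => fg0.
have := iM [:: f; g] (fun=> 1).
rewrite !big_cons big_nil !mul1r addr0 /= inE fg => /(_ isT (fun=> lcoef1 s) fg0 f).
by rewrite mem_head => /(_ isT)/eqP; rewrite oner_eq0.
Qed.

End Span.

(** * The integer form of a skew-symmetric matrix *)

Section BilinearForm.
Variables (N : nat).
Local Notation vec := 'cV[int]_N.
Implicit Types (L E : 'M[int]_N) (f g h : vec).

Lemma bformDl L f g h : bform L (f + g) h = bform L f h + bform L g h.
Proof. by rewrite /bform linearD /= !mulmxDl mxE. Qed.

Lemma bformDr L f g h : bform L f (g + h) = bform L f g + bform L f h.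
Proof. by rewrite /bform mulmxDr mxE. Qed.

Lemma bformZl L a f g : bform L (a *: f) g = a * bform L f g.
Proof. by rewrite /bform linearZ /= -!scalemxAl mxE. Qed.

Lemma bformZr L a f g : bform L f (a *: g) = a * bform L f g.
Proof. by rewrite /bform -scalemxAr mxE. Qed.

Lemma bformNl L f g : bform L (- f) g = - bform L f g.
Proof. by rewrite -scaleN1r bformZl mulN1r. Qed.

Lemma bformNr L f g : bform L f (- g) = - bform L f g.
Proof. by rewrite -scaleN1r bformZr mulN1r. Qed.

Lemma bform0l L g : bform L 0 g = 0.
Proof. by rewrite -(scale0r 0) bformZl mul0r. Qed.

Lemma bform0r L f : bform L f 0 = 0.
Proof. by rewrite -(scale0r 0) bformZr mul0r. Qed.

Lemma bformC L f g : L^T = - L -> bform L f g = - bform L g f.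
Proof.
move=> sk; rewrite /bform -[in LHS](trmxK (_ *m _ *m g)) mxE.
by rewrite !trmx_mul trmxK sk mulNmx mulmxN mulmxA mxE.
Qed.

Lemma bform_diag L f : L^T = - L -> bform L f f = 0.
Proof. by move=> sk; have := bformC f f sk; lia. Qed.

Lemma bform_conj L E f g : bform (E^T *m L *m E) f g = bform L (E *m f) (E *m g).
Proof. by rewrite /bform trmx_mul !mulmxA. Qed.

Lemma bform_evec L i j : bform L (evec i) (evec j) = L i j.
Proof. by rewrite /bform /evec trmx_delta -rowE -colE !mxE. Qed.

Lemma bform_evec_sum L i f (r : seq 'I_N) :
  bform L (evec i) (\sum_(j <- r) f j 0 *: evec j) = \sum_(j <- r) f j 0 * L i j.
Proof.
elim: r => [|j r IHr]; first by rewrite !big_nil bform0r.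
by rewrite !big_cons bformDr bformZr bform_evec IHr.
Qed.

Lemma vec_sum f : f = \sum_(i < N) f i 0 *: evec i.
Proof.
rewrite {1}[f]matrix_sum_delta; apply: eq_bigr => i _.
by rewrite big_ord1.
Qed.

Lemma evecE (i j : 'I_N) : evec i j ord0 = (j == i)%:R.
Proof. by rewrite mxE andbT. Qed.

End BilinearForm.

(** * Toric frames and their reconstruction from the basis vectors *)

Section Frames.
Variables (N : nat) (R : unitRingType) (s : R).
Hypotheses (cs : central s) (us : s \is a GRing.unit).
Local Notation vec := 'cV[int]_N.
Variables (L : 'M[int]_N) (M : vec -> R).
Hypotheses (skewL : L^T = - L) (frM : frame_rel s L M).

Let M0 : M 0 = 1. Proof. by case: frM. Qed.
Let MM f g : M f * M g = s ^ (bform L f g) * M (f + g).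
Proof. by case: frM => _ /(_ f g). Qed.

Lemma frameMN f : M f * M (- f) = 1.
Proof. by rewrite MM bformNr bform_diag // oppr0 expr0z subrr M0 mul1r. Qed.

Lemma frame_unit f : M f \is a GRing.unit.
Proof.
apply/unitrP; exists (M (- f)); split; last exact: frameMN.
by have := frameMN (- f); rewrite opprK.
Qed.

Lemma frameN f : M (- f) = (M f)^-1.
Proof. by apply: (mulrI (frame_unit f)); rewrite frameMN divrr // frame_unit. Qed.

Lemma frame_qcomm f g : M f * M g = s ^ (2 * bform L f g) * (M g * M f).
Proof.
by rewrite !MM mulXzA // addrC (bformC g f skewL) addrC; congr (s ^ _ * _); lia.
Qed.

Lemma frameXz f n : M (n *: f) = M f ^ n.
Proof.
have nat_case k : M (k%:Z *: f) = M f ^+ k.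
  elim: k => [|k IHk]; first by rewrite scale0r.
  rewrite exprS -IHk MM bformZr bform_diag // mulr0 expr0z mul1r.
  by congr (M _); rewrite -{2}[f]scale1r -scalerDl; congr (_ *: _); lia.
case: (intP n) => [|k|k]; [exact: (nat_case 0%N)|exact: nat_case|].
by rewrite scaleNr frameN nat_case exprnN.
Qed.

(** Since [r] is increasing, multiplying by the head on the left contributes exactly the exponents
    of the pairs [i < j] with [i] the head. *)
Lemma frame_prod (r : seq 'I_N) (f : vec) : pairwise (fun i j : 'I_N => (i < j)%N) r ->
  \prod_(i <- r) M (evec i) ^ f i 0 =
  s ^ (\sum_(i <- r) \sum_(j <- r | (i < j)%N) f i 0 * f j 0 * L i j)
    * M (\sum_(i <- r) f i 0 *: evec i).
Proof.
elim: r => [|i r IHr]; first by rewrite !big_nil M0 mulr1.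
rewrite pairwise_cons => /andP[/allP ir pr]; rewrite !big_cons IHr // -frameXz.
rewrite mulrXzCA // MM mulXzA // ltnn; congr (s ^ _ * _).
rewrite addrC; congr (_ + _).
  rewrite bformZl bform_evec_sum mulr_sumr big_seq [RHS]big_seq_cond.
  by apply: eq_big => j; [case: (boolP (j \in r)) => // /ir -> | rewrite mulrA].
apply: eq_big_seq => j jr; rewrite big_cons ifN //.
by rewrite -leqNgt ltnW // ir.
Qed.

Lemma frame_ofE f : frame_of s L (fun i => M (evec i)) f = M f.
Proof.
have enumE : index_enum 'I_N = enum 'I_N by rewrite enumT [index_enum _]unlock.
rewrite /frame_of !enumE frame_prod; last first.
  have: pairwise ltn (map val (enum 'I_N)).
    by rewrite val_enum_ord -sorted_pairwise ?iota_ltn_sorted //; apply: ltn_trans.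
  by rewrite pairwise_map.
by rewrite mulXzA // addNr expr0z mul1r {2}[f]vec_sum enumE.
Qed.

End Frames.

(** * Compatible pairs under matrix mutation *)

Section SeedData.
Variables (N : nat) (ex : {set 'I_N}) (d : 'I_N -> int).
Hypothesis d_gt0 : forall j, j \in ex -> 0 < d j.
Local Notation vec := 'cV[int]_N.
Implicit Types (L B : 'M[int]_N).

(** Compatibility as an identity of linear forms, so that it can be transported along [mutE] without
    matrix entries. *)
Definition compatible L B := forall j, j \in ex -> forall x : vec,
  bform L (col j B) x = d j * x j 0.

Lemma compatibleP L B :
  (forall i j, j \in ex -> \sum_(k < N) B k j * L k i = (i == j)%:R * d j) ->
  compatible L B.
Proof.
move=> cBL j jex x; rewrite /bform mxE (bigD1 j) //= big1 => [|i ij].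
  have -> : d j = (j == j)%:R * d j by rewrite eqxx mul1r.
  by rewrite addr0 mxE -cBL //; congr (_ * _); apply: eq_bigr => k _; rewrite !mxE.
rewrite mxE (eq_bigr (fun k => B k j * L k i)) => [|k _]; last by rewrite !mxE.
by rewrite cBL // (negPf ij) !mul0r.
Qed.

Lemma mutE_mul k B (f : vec) i : (mutE k B *m f) i 0 =
  if i == k then - f k 0 else f i 0 + Num.max 0 (- B i k) * f k 0.
Proof.
rewrite mxE (bigD1 k) //= mxE eqxx.
have [->|ik] := eqVneq i k.
  rewrite big1 ?mulN1r ?addr0 // => j jk.
  by rewrite mxE (negPf jk) eq_sym (negPf jk) mul0r.
rewrite addrC (bigD1 i) //= mxE (negPf ik) eqxx mul1r big1 ?addr0 // => j /andP[jk ji].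
by rewrite mxE (negPf jk) eq_sym (negPf ji) mul0r.
Qed.

Lemma compatible_skew L B i j : L^T = - L -> compatible L B -> i \in ex -> j \in ex ->
  d i * B i j = - (d j * B j i).
Proof.
move=> sk cL iex jex.
by have := bformC (col i B) (col j B) sk; rewrite !cL // !mxE.
Qed.

Lemma compatible_diag L B k : L^T = - L -> compatible L B -> k \in ex -> B k k = 0.
Proof.
move=> sk cL kex; have := compatible_skew sk cL kex kex; have := d_gt0 kex; nia.
Qed.

(** In each sign case the numerator is zero or twice an integer, so the integer division is exact.
    This is the usual rewriting of matrix mutation with positive parts. *)
Lemma exchange_half (x y : int) :
  ((`|x| * y + x * `|y|) %/ 2)%Z = Num.max 0 (- x) * y + Num.max 0 y * x.
Proof.
have half (z : int) : ((z + z) %/ 2)%Z = z by lia.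
have [x0|x0] := leP 0 x; have [y0|y0] := leP 0 y.
- rewrite (ger0_norm x0) (ger0_norm y0) max_l ?oppr_le0 // half.
  by rewrite mul0r add0r mulrC.
- rewrite (ger0_norm x0) (ltr0_norm y0) max_l ?oppr_le0 //.
  by rewrite mulrN subrr div0z !mul0r.
- rewrite (ltr0_norm x0) (ger0_norm y0) max_r ?oppr_ge0 ?ltW //.
  by rewrite mulNr addNr div0z (mulrC y) addNr.
- rewrite (ltr0_norm x0) (ltr0_norm y0) max_r ?oppr_ge0 ?ltW //.
  by rewrite mulNr mulrN half mul0r addr0.
Qed.

(** Read in the old coordinates, a mutated column is the old one plus a multiple of column [k];
    compatibility after mutation then follows by bilinearity. *)
Lemma mutE_col_mutB k B j : B k k = 0 ->
  mutE k B *m col j (mutB k B) =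
  if j == k then - col k B else col j B + Num.max 0 (B k j) *: col k B.
Proof.
move=> Bkk; apply/matrixP => i z; rewrite (ord1 z) mutE_mul.
have [->|jk] := eqVneq j k; have [->|ik] := eqVneq i k;
  rewrite !mxE ?eqxx ?(negPf jk) ?(negPf ik) ?orbT /=.
- by rewrite Bkk.
- by rewrite Bkk oppr0 mulr0 addr0.
- by rewrite Bkk; ring.
- by rewrite exchange_half; ring.
Qed.

Lemma compatible_mut L B k : L^T = - L -> compatible L B -> k \in ex ->
  compatible (mutL k B L) (mutB k B).
Proof.
move=> sk cL kex j jex x; have Bkk := compatible_diag sk cL kex.
rewrite /mutL bform_conj mutE_col_mutB //.
have [->|jk] := eqVneq j k.
  by rewrite bformNl cL // mutE_mul eqxx mulrN opprK.
rewrite bformDl bformZl !cL // !mutE_mul eqxx (negPf jk).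
(* The positive multipliers [d j] and [d k] pass inside the maximum, where skew-symmetrizability
   exchanges the two entries. *)
have E : d j * Num.max 0 (- B j k) = d k * Num.max 0 (B k j).
  rewrite !maxr_pMr ?ltW ?d_gt0 // !mulr0 (compatible_skew sk cL kex jex).
  by rewrite mulrN.
by rewrite mulrDr (mulrA (d j)) E; ring.
Qed.

Lemma skew_mut L B k : L^T = - L -> (mutL k B L)^T = - mutL k B L.
Proof.
by move=> sk; rewrite /mutL !trmx_mul trmxK sk mulNmx mulmxN mulmxA.
Qed.

End SeedData.

(** * Mutation of a frame in one direction *)

Section FrameMutation.
Variables (N : nat) (R : unitRingType) (s : R).
Hypotheses (cs : central s) (us : s \is a GRing.unit).
Local Notation vec := 'cV[int]_N.
Variables (L E : 'M[int]_N) (M : vec -> R) (k : 'I_N) (b n : vec) (dk : int).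
Hypotheses (skewL : L^T = - L) (frM : frame_rel s L M).
Hypotheses (Lb : forall x : vec, bform L b x = dk * x k 0) (bk : b k 0 = 0).
Hypothesis nk : n k 0 = -1.

Let trunc (f : vec) : vec := f - f k 0 *: evec k.

Hypothesis mulE : forall f : vec, E *m f = f - f k 0 *: evec k + f k 0 *: n.

Let y := M (n + b) + M n.
Hypothesis uy : y \is a GRing.unit.

Let trunck f : trunc f k 0 = 0.
Proof. by rewrite !mxE !eqxx mulr1 subrr. Qed.

Let truncD f g : trunc (f + g) = trunc f + trunc g.
Proof. by rewrite /trunc mxE scalerDl opprD addrACA. Qed.

(** The exponents of the two terms of [y] differ by [b], which pairs to zero with [h], so both terms
    commute with [M h] up to the same power of [s]. *)
Let y_qcomm (h : vec) : h k 0 = 0 -> y * M h = s ^ (2 * bform L n h) * (M h * y).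
Proof.
move=> hk; have Lnb : bform L (n + b) h = bform L n h.
  by rewrite bformDl Lb hk mulr0 addr0.
by rewrite mulrDl !(frame_qcomm us skewL frM _ h) Lnb -mulrDr -mulrDr.
Qed.

(* The frame that agrees with M on the exponents vanishing at k and sends the
   k-th basis vector to M (n + b) + M n. *)
Definition mut_frame (f : vec) : R :=
  s ^ (- (f k 0 * bform L (trunc f) n)) * (M (trunc f) * y ^ f k 0).

(** Moving [M h'] to the left of [y ^ i] reduces the claim to an identity between exponents of [s],
    which follows from bilinearity and skew-symmetry. *)
Lemma mut_frame_rel : frame_rel s (E^T *m L *m E) mut_frame.
Proof.
have [M0 MM] := frM; split; rewrite /mut_frame.
  by rewrite /trunc mxE scale0r subrr M0 mul0r oppr0 !expr0z !mulr1.
move=> f g; rewrite bform_conj !mulE -!/(trunc _) truncD [(f + g) k 0]mxE.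
move: (trunck f) (trunck g); move: (trunc f) (trunc g) (f k 0) (g k 0).
move=> h h' i j hk h'k.
have exch : y ^ i * M h' = s ^ (i * (2 * bform L n h')) * (M h' * y ^ i).
  by apply: (qcommXz cs us _ uy); apply: y_qcomm.
rewrite (mulrXzCA cs) -!(mulrA (s ^ _)) mulXzA // -(mulrA (M h)) (mulrA (y ^ i)) exch.
rewrite -!mulrA (mulrXzCA cs) mulXzA // (mulrA (M h) (M h')) MM -!mulrA mulXzA //.
rewrite -(exprzDr uy) mulXzA //; congr (s ^ _ * _).
rewrite !(bformDl, bformDr, bformZl, bformZr) (bform_diag n skewL).
rewrite (bformC n h' skewL).
ring.
Qed.

Lemma mut_frame_evec j : mut_frame (evec j) = if j == k then y else M (evec j).
Proof.
have [M0 _] := frM; rewrite /mut_frame evecE eq_sym /trunc evecE eq_sym.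
have [->|jk] := eqVneq j k.
  by rewrite scale1r subrr bform0l mulr0 oppr0 expr0z M0 !mul1r.
by rewrite scale0r subr0 mul0r oppr0 !expr0z mul1r mulr1.
Qed.

(* Multiplying by a power of y makes all its exponents natural; then y ^ m is a
   combination of M-monomials of k-degree - m, so that a relation splits
   according to the k-degree and y can be cancelled from each part. *)
Lemma mut_frame_indep : indep s M -> indep s mut_frame.
Proof.
move=> iM S c uS cc sum0 f0 f0S.
have spany m : lspan s M (fun g => g k 0 = - m%:Z) (y ^+ m).
  elim: m => [|m IHm]; last rewrite exprS.
    by rewrite expr0; have [<- _] := frM; apply: lspan_gen; rewrite mxE.
  apply: (lspanM cs us (P := fun g => g k 0 = -1) frM _ _ IHm).
    by move=> f g fk gk; rewrite mxE fk gk; lia.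
  by apply: (lspanD); apply: lspan_gen; rewrite ?mxE nk ?bk.
have [m0 m0P] : exists m0 : nat, forall f, f \in S -> 0 <= f k 0 + m0%:Z.
  elim: (S) => [|f T [m0 m0P]]; first by exists 0%N.
  pose z := f k 0; exists (absz z + m0)%N => g; rewrite inE PoszD.
  by move=> /orP[/eqP->|/m0P]; rewrite -?/z; lia.
pose a f := c f * s ^ (- (f k 0 * bform L (trunc f) n)).
have ca f : lcoef s (a f) by apply: lcoefM => //; apply: lcoefXz.
pose A f := a f * M (trunc f).
pose u (f : vec) := y ^+ absz (f k 0 + m0%:Z)%R.
have sumA : \sum_(f <- S) A f * u f = 0.
  transitivity ((\sum_(f <- S) c f * mut_frame f) * y ^+ m0); last by rewrite sum0 mul0r.
  rewrite mulr_suml; apply: eq_big_seq => f fS.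
  have -> : u f = y ^ f k 0 * y ^ m0%:Z.
    by rewrite -exprzDr // /u exprnP; congr (_ ^ _); apply: gez0_abs; apply: m0P.
  by rewrite /A /a /mut_frame -!mulrA.
have A_span f : f \in S -> lspan s M (fun g => g k 0 = - (f k 0 + m0%:Z)) (A f * u f).
  move=> fS; rewrite -(gez0_abs (m0P f fS)).
  apply: (lspanM cs us (P := fun g => g k 0 = 0) frM _ _ (spany _)).
    by move=> g h gk hk; rewrite mxE gk hk add0r.
  exact: lspan_term.
pose m := f0 k 0.
(* Terms with different [f k 0] involve monomials of different [k]-degree, so the part with
   [f k 0 = m] vanishes by itself. All its terms share the same right factor [u f0]. *)
have part0 : \sum_(f <- S | f k 0 == m) A f * u f = 0.
  apply: (indep_lspan_disjoint cs us (P := fun g => g k 0 = - (m + m0%:Z)) iM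
            (y := \sum_(f <- S | f k 0 != m) A f * u f)).
  - rewrite -big_filter; apply: lspan_sum => f; rewrite mem_filter => /andP[/eqP <-].
    exact: A_span.
  - rewrite -big_filter; apply: lspan_sum => f; rewrite mem_filter => /andP[fm /A_span].
    by apply: lspanW => g ->; move=> /oppr_inj/addIr gm; rewrite gm eqxx in fm.
  by move: sumA; rewrite (bigID (fun f : vec => f k 0 == m)).
have uf0 : u f0 \is a GRing.unit by rewrite unitrX.
have sumAm : \sum_(f <- S | f k 0 == m) A f = 0.
  apply: (mulIr uf0); rewrite mul0r -[RHS]part0 mulr_suml.
  by apply: eq_bigr => f /eqP fm; rewrite /u fm.
(* At fixed [k]-degree [m] the truncation is injective, with inverse [ext]; hence [sumAm] is a
   relation between distinct monomials of [M]. *)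
pose ext (g : vec) := g + m *: evec k.
have extK (f : vec) : f k 0 = m -> ext (trunc f) = f by move=> fm; rewrite /ext -fm addrNK.
have a0 : a f0 = 0.
  suff: (a \o ext) (trunc f0) = 0 by rewrite /= extK.
  pose S' := map trunc [seq f : vec <- S | f k 0 == m].
  apply: (iM S'); rewrite /S'.
  - rewrite map_inj_in_uniq ?filter_uniq // => f g.
    rewrite !mem_filter => /andP[/eqP fm _] /andP[/eqP gm _] fg.
    by rewrite -(extK f) // fg extK.
  - by move=> f; apply: ca (ext f).
  - rewrite big_map big_filter -[RHS]sumAm; apply: eq_bigr => f /eqP fm.
    by rewrite /= extK.
  by apply: map_f; rewrite mem_filter eqxx.
by apply: (mulIr (unitrXz _ us)); rewrite mul0r; apply: a0.
Qed.

End FrameMutation.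

(** * Seeds carried by independent frames *)

Section SeedFrames.
Variables (N : nat) (R : unitRingType) (s : R) (ex : {set 'I_N}) (d : 'I_N -> int).
Hypotheses (cs : central s) (us : s \is a GRing.unit) (divR : is_divring R).
Hypothesis d_gt0 : forall j, j \in ex -> 0 < d j.
Local Notation vec := 'cV[int]_N.

(** The invariant of mutation. A seed stores only the values on basis vectors; [M] is the full frame
    behind them, with its independence. *)
Record framed (S : seedT N R) (M : vec -> R) : Prop := Framed {
  framed_skew : (sL S)^T = - sL S;
  framed_compatible : compatible ex d (sL S) (sB S);
  framed_rel : frame_rel s (sL S) M;
  framed_indep : indep s M;
  framed_evec : forall i, sv S i = M (evec i) }.

Lemma framed_of S M f : framed S M -> frame_of s (sL S) (sv S) f = M f.
Proof.
move=> FS; rewrite -(frame_ofE cs us (framed_skew FS) (framed_rel FS)) /frame_of.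
by congr (_ * _); apply: eq_bigr => i _; rewrite (framed_evec FS).
Qed.

(** The two exchange monomials have exponents differing by column [k], which is the shape
    [M (n + b) + M n] used for frame mutation. *)
Lemma mut_pos_neg k (B : 'M[int]_N) :
  - evec k + pospart (col k B) = - evec k - negpart (col k B) + col k B.
Proof.
apply/matrixP => i z; rewrite !mxE (ord1 z).
by have [?|?] := leP (B i k) 0; rewrite ?addr0 ?addrNK ?subr0.
Qed.

Lemma mut_neg_diag k (B : 'M[int]_N) : B k k = 0 ->
  (- evec k - negpart (col k B)) k 0 = -1.
Proof. by move=> Bkk; rewrite !mxE Bkk !eqxx minxx subr0. Qed.

Lemma mutE_decomp k (B : 'M[int]_N) (f : vec) : B k k = 0 ->
  mutE k B *m f = f - f k 0 *: evec k + f k 0 *: (- evec k - negpart (col k B)).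
Proof.
move=> Bkk; apply/matrixP => i z; rewrite (ord1 z) mutE_mul !mxE !andbT.
have [->|ik] := eqVneq i k; first by rewrite Bkk minxx /= mulr1n; ring.
rewrite mulr0 subr0 oppr0 add0r; congr (_ + _); rewrite mulrC; congr (_ * _).
have [?|?] := leP (B i k) 0; first by rewrite max_r ?oppr_ge0.
by rewrite max_l ?oppr0 ?oppr_le0 ?ltW.
Qed.

Lemma framed_mut S M k : framed S M -> k \in ex -> exists M', framed (mut_seed s k S) M'.
Proof.
move=> FS kex; have [sk cL fr ind evecM] := FS.
have Bkk := compatible_diag d_gt0 sk cL kex.
pose n := - evec k - negpart (col k (sB S)); pose b := col k (sB S).
have bk : b k 0 = 0 by rewrite mxE.
have Lb : forall x : vec, bform (sL S) b x = d k * x k 0 by apply: cL.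
(* Pairing [b] with the [k]-th basis vector gives [d k > 0]. So the two exchange exponents differ,
   and independence makes the new cluster variable nonzero, hence invertible. *)
have b0 : b != 0.
  apply/eqP => b0; have := Lb (evec k); rewrite b0 bform0l evecE eqxx mulr1.
  by have := d_gt0 kex; lia.
have uy : M (n + b) + M n \is a GRing.unit.
  by apply: divR; apply: (indep_neq ind); rewrite -subr_eq0 addrC addKr.
exists (mut_frame s (sL S) M k b n); split=> /=.
- exact: skew_mut.
- exact: compatible_mut.
- by apply: (mut_frame_rel cs us sk fr Lb) => // f; apply: mutE_decomp.
- by apply: (mut_frame_indep cs us fr _ _ uy) => //; apply: mut_neg_diag.
move=> j; rewrite (mut_frame_evec k b n fr) !(framed_of _ FS) evecM.
by rewrite /n -mut_pos_neg.
Qed.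

End SeedFrames.

Lemma seq_choice (T : eqType) (W : Type) (w0 : W) (Q : T -> W -> Prop) (S : seq T) :
  (forall x, x \in S -> exists w, Q x w) -> exists g, forall x, x \in S -> Q x (g x).
Proof.
elim: S => [|x S IHS] QS; first by exists (fun=> w0).
have [|g gP] := IHS; first by move=> y yS; apply: QS; rewrite inE yS orbT.
have [w Qw] := QS x (mem_head _ _).
exists (fun y => if y == x then w else g y) => y; rewrite inE.
by have [->|_] := eqVneq y x => //= /gP.
Qed.

(** * Independence for quantum and root of unity toric frames *)

Section ToricFrames.
Variables (N : nat) (R : unitRingType) (s : R) (L : 'M[int]_N) (M : 'cV[int]_N -> R).

(** Injectivity applied to the single monomial [M 0 = 1]: the quantum parameter is
    transcendental. *)
Lemma q_toric_frame_root p : q_toric_frame s L M -> pev p s = 0 -> p = 0.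
Proof.
move=> [[M0 _] [inj _]] p0; apply: (inj [:: (0, (p, 0%N))] isT _ (0, (p, 0%N))).
  by rewrite big_seq1 /= p0 !mul0r.
exact: mem_head.
Qed.

Lemma q_toric_frame_indep : q_toric_frame s L M -> indep s M.
Proof.
move=> [_ [inj _]] S c uS cc sum0.
have [g gP] := seq_choice (0, 0%N)
  (Q := fun f w => c f = pev w.1 s * s ^- w.2) (S := S)
  (fun f _ => let: ex_intro p (ex_intro k E) := cc f in ex_intro _ (p, k) E).
move=> f fS; rewrite gP //.
have := inj [seq (f, g f) | f <- S] _ _ (f, g f) (map_f _ fS).
rewrite -map_comp map_id => /(_ uS) /= ->; first by rewrite pev0 mul0r.
by rewrite big_map -[RHS]sum0; apply: eq_big_seq => h hS /=; rewrite -gP.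
Qed.

Lemma ru_toric_frame_indep l : (0 < l)%N -> s ^+ l = 1 ->
  ru_toric_frame s L M -> indep s M.
Proof.
move=> l0 sl [_ [inj _]] S c uS cc sum0.
have cc' f : exists p, c f = pev p s.
  (* Since [s ^+ l = 1], the factor [s ^- k] equals [s ^+ (k * l.-1)], so Laurent coefficients are
     polynomial ones. *)
  have [p [k ->]] := cc f; exists (p * 'X^(k * l.-1)).
  have us : s \is a GRing.unit by rewrite -(unitrX_pos _ l0) sl unitr1.
  rewrite pevM pevXn; congr (_ * _); apply: (mulrI (unitrX k us)).
  by rewrite divrr ?unitrX // -exprD -mulnS prednK // mulnC exprM sl expr1n.
have [g gP] := seq_choice 0 (fun f (_ : f \in S) => cc' f).
move=> f fS; rewrite gP //.
have := inj [seq (f, g f) | f <- S] _ _ (f, g f) (map_f _ fS).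
rewrite -map_comp map_id => /(_ uS) /= -> //.
by rewrite big_map -[RHS]sum0; apply: eq_big_seq => h hS /=; rewrite -gP.
Qed.

End ToricFrames.

Lemma subring_gen_Xn (R : unitRingType) (P : R -> Prop) x n :
  subring_gen P x -> subring_gen P (x ^+ n).
Proof.
by move=> Px; elim: n => [|n IHn]; [apply: sg_one | rewrite exprS; apply: sg_mul].
Qed.

Lemma subring_gen_pev (R : unitRingType) (P : R -> Prop) p x :
  subring_gen P x -> subring_gen P (pev p x).
Proof.
have P0 : subring_gen P 0.
  by rewrite -(subrr 1); apply: sg_add (sg_one P) (sg_opp (sg_one P)).
have Pn n : subring_gen P n%:R.
  by elim: n => [|n IHn] //; rewrite -addn1 natrD; apply: sg_add IHn (sg_one P).
move=> Px; apply: (big_ind (subring_gen P)) => // [|i _]; first exact: sg_add.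
apply: sg_mul; last exact: subring_gen_Xn.
case: (intP p`_i) => [|n|n] //; first by rewrite -pmulrn.
by rewrite mulrNz -pmulrn; apply: sg_opp.
Qed.

(** * The specialization map as a graph in the product ring *)

Section Specialization.
Variables (N : nat) (D F : unitRingType) (t : D) (e : F).
Hypotheses (ct : central t) (ut : t \is a GRing.unit).
Hypotheses (ce : central e) (ue : e \is a GRing.unit).
Local Notation vec := 'cV[int]_N.
Variables (L : 'M[int]_N) (X : vec -> D) (M : vec -> F).
Hypotheses (skewL : L^T = - L) (frX : frame_rel t L X) (frM : frame_rel e L M).
Hypothesis indX : indep t X.
Hypothesis transc : forall p, pev p t = 0 -> p = 0.

(* The graph of kappa is the span of the pairs (X f, M f) in the product ring
   D * F, over the Laurent polynomials in (t, e). *)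
Local Notation te := ((t, e) : (D * F)%type).
Let XM (f : vec) : (D * F)%type := (X f, M f).

Let cte : central te.
Proof. by case=> x y; congr (_, _); [apply: ct | apply: ce]. Qed.

Let ute : te \is a GRing.unit.
Proof. by apply/andP; split. Qed.

Lemma pairXn n : te ^+ n = (t ^+ n, e ^+ n).
Proof. by elim: n => // n IHn; rewrite !exprS IHn. Qed.

Lemma pairVn n : te ^- n = (t ^- n, e ^- n).
Proof.
apply: (mulrI (unitrX n ute)); rewrite divrr ?unitrX // pairXn.
by congr (_, _); rewrite divrr ?unitrX.
Qed.

Lemma pairXz n : te ^ n = (t ^ n, e ^ n).
Proof. by case: (intP n) => [|k|k] //; [apply: pairXn | apply: pairVn]. Qed.

Lemma pair_pev p : pev p te = (pev p t, pev p e).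
Proof.
rewrite [LHS]surjective_pairing; congr (_, _); rewrite /pev raddf_sum;
  by apply: eq_bigr => i _; rewrite pairXn /= rmorph_int.
Qed.

Let frXM : frame_rel te L XM.
Proof.
have [X0 XX] := frX; have [M0 MM] := frM.
split=> [|f g]; first by rewrite /XM X0 M0.
by rewrite pairXz; congr (_, _); [apply: XX | apply: MM].
Qed.

Let graph (z : D * F) := lspan te XM (fun _ => True) z.

Lemma kappaP x y : kappa t X e M x y <-> graph (x, y).
Proof.
split=> [[c [-> ->]]|].
  elim: c => [|[f [p k]] c IHc]; first by rewrite !big_nil; apply: lspan0.
  rewrite !big_cons /=.
  have := @lspan_cons _ _ te XM (fun=> True) (pev p te * te ^- k) f _ _ I IHc.
  by rewrite pair_pev pairVn; apply; exists p, k; rewrite pair_pev pairVn.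
have: forall z, graph z -> kappa t X e M z.1 z.2; last by move=> /[apply].
move=> z; elim=> [|u f w [p [k ->]] _ _ [c [Ex Ey]]].
  by exists [::]; rewrite !big_nil.
exists ((f, (p, k)) :: c); rewrite !big_cons /= -Ex -Ey.
by rewrite pair_pev pairVn.
Qed.

(** Independence of [X] kills every coefficient at [t]. As [t] is transcendental, the numerators are
    zero polynomials, so the coefficients at [e] vanish too. By additivity the graph is then
    single-valued. *)
Lemma graph0_inj y : graph (0, y) -> y = 0.
Proof.
move=> /(lspan_rep cte ute)[S [c [uS cc _ E]]].
have E1 : \sum_(f <- S) (c f).1 * X f = 0.
  by have := congr1 fst E; rewrite raddf_sum => <-.
have c0 f : f \in S -> c f = 0.
  have cc1 g : lcoef t (c g).1.
    by have [p [k ->]] := cc g; rewrite pair_pev pairVn; exists p, k.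
  move=> fS; have := indX uS cc1 E1 fS; have [p [k ->]] := cc f.
  rewrite pair_pev pairVn /= => p0.
  have -> : p = 0.
    apply: transc; apply: (mulIr (_ : t ^- k \is a GRing.unit)).
      by rewrite unitrV unitrX.
    by rewrite mul0r.
  by rewrite !pev0 !mul0r.
have -> : y = (\sum_(f <- S) c f * XM f).2 by rewrite -E.
by rewrite big_seq big1 // => f fS; rewrite c0 // mul0r.
Qed.

Lemma graph_fun x y z : graph (x, y) -> graph (x, z) -> y = z.
Proof.
move=> gy gz; apply/eqP; rewrite -subr_eq0; apply/eqP/graph0_inj.
by have := lspanD gy (lspanN cte ute gz); rewrite /graph -[_ + _]/(x - x, y - z) subrr.
Qed.

Lemma graphM x y x' y' : graph (x, y) -> graph (x', y') -> graph (x * x', y * y').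
Proof. exact: (lspanM cte ute frXM). Qed.

Lemma graph_pev p : graph (pev p t, pev p e).
Proof.
have [X0 _] := frX; have [M0 _] := frM.
have := @lspan_term _ _ te XM (fun=> True) (pev p te) 0 _ I.
rewrite pair_pev /XM X0 M0 -[_ * _]/(pev p t * 1, pev p e * 1) !mulr1.
by apply; exists p, 0%N; rewrite invr1 mulr1 pair_pev.
Qed.

Lemma graph_Xz n : graph (t ^ n, e ^ n).
Proof.
have [X0 _] := frX; have [M0 _] := frM.
have := @lspan_term _ _ te XM (fun=> True) (te ^ n) 0 (lcoefXz te n) I.
by rewrite pairXz /XM X0 M0 -[_ * _]/(t ^ n * 1, e ^ n * 1) !mulr1.
Qed.

Lemma graph1 : graph (1, 1).
Proof. exact: (graph_Xz 0). Qed.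

(** Exponents are nonnegative because the graph is closed under products, while inverses of the
    [v i] may leave it. *)
Lemma graph_frame (L' : 'M[int]_N) (v : 'I_N -> D) (w : 'I_N -> F) (f : vec) :
    (forall i, graph (v i, w i)) -> (forall i, 0 <= f i 0) ->
  graph (frame_of t L' v f, frame_of e L' w f).
Proof.
move=> vw f0; rewrite /frame_of; apply: (graphM (graph_Xz _)).
elim: (index_enum _) => [|i r IHr]; first by rewrite !big_nil; apply: graph1.
rewrite !big_cons; apply: (graphM _ IHr).
rewrite -(gez0_abs (f0 i)); elim: (absz _) => [|n IHn]; first exact: graph1.
by rewrite -!exprnP !exprS; apply: (graphM (vw i)).
Qed.

Local Notation kap := (kappa t X e M).

Lemma kappa_fun x y z : kap x y -> kap x z -> y = z.
Proof. by move=> /kappaP gy /kappaP; apply: graph_fun. Qed.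

Lemma kappaD x y x' y' : kap x y -> kap x' y' -> kap (x + x') (y + y').
Proof. by move=> /kappaP g /kappaP g'; apply/kappaP; apply: lspanD g g'. Qed.

Lemma kappaN x y : kap x y -> kap (- x) (- y).
Proof. by move=> /kappaP g; apply/kappaP; apply: (lspanN cte ute g). Qed.

Lemma kappaM x y x' y' : kap x y -> kap x' y' -> kap (x * x') (y * y').
Proof. by move=> /kappaP g /kappaP g'; apply/kappaP; apply: graphM. Qed.

Lemma kappa_Xz n : kap (t ^ n) (e ^ n).
Proof. exact/kappaP/graph_Xz. Qed.

Lemma kappa_pev p : kap (pev p t) (pev p e).
Proof. exact/kappaP/graph_pev. Qed.

Lemma kappa_frame f : kap (X f) (M f).
Proof. by apply/kappaP; apply: (lspan_gen te XM (P := fun=> True)). Qed.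

Section Mutations.
Variables (ex : {set 'I_N}) (d : 'I_N -> int) (B : 'M[int]_N).
Hypotheses (divD : is_divring D) (divF : is_divring F).
Hypothesis d_gt0 : forall j, j \in ex -> 0 < d j.
Hypotheses (cLB : compatible ex d L B) (indM : indep e M).
Let SD := Seed L B (fun i => X (evec i)).
Let SF := Seed L B (fun i => M (evec i)).
Hypothesis laurent : forall x, cluster_var t ex SD x -> exists y, kap x y.

(* Each exchange relation v_k v'_k = P(v) lies in the graph of kappa, which is
   a function: its value at v'_k is found by cancelling the nonzero v_k in F. *)
Lemma kappa_mut_seq ks : all (fun k => k \in ex) ks ->
  forall i, kap (sv (mut_seq t ks SD) i) (sv (mut_seq e ks SF) i).
Proof.
move=> ksex i; apply/kappaP; move: i.
suff [_ [_ [_ [_ H]]]] : let S := mut_seq t ks SD in let S' := mut_seq e ks SF in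
    sL S = sL S' /\ sB S = sB S' /\ (exists X', framed t ex d S X') /\
    (exists M', framed e ex d S' M') /\ forall i, graph (sv S i, sv S' i).
  exact: H.
elim/last_ind: ks ksex => [_|ks k IHks] /=.
  split=> //; split=> //; split; first by exists X; split.
  split; first by exists M; split.
  by move=> i; apply: lspan_gen.
rewrite all_rcons => /andP[kex ksex] /=; have := IHks ksex.
(* The hypothesis [laurent] provides some value of [kappa] at the new variable; the rest of the step
   identifies it. *)
have lau i : exists y, graph (sv (mut_seq t (rcons ks k) SD) i, y).
  have [|y /kappaP ?] := laurent (x := sv (mut_seq t (rcons ks k) SD) i); last by exists y.
  by exists (rcons ks k); split; [rewrite all_rcons kex | exists i].
move: lau; rewrite /mut_seq !foldl_rcons -!/(mut_seq _ _ _).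
move: (mut_seq t ks SD) (mut_seq e ks SF) => S S' lau.
move=> [EL [EB [[X' FX] [[M' FM] g]]]].
split; first by rewrite /= EL EB.
split; first by rewrite /= EB.
split; first exact: framed_mut FX kex.
split; first exact: framed_mut FM kex.
move=> i; have [z] := lau i; rewrite /=.
have [_|_] := eqVneq i k; last by move=> _; apply: g.
rewrite !(framed_of _ _ _ FX) // !(framed_of _ _ _ FM) // -EB.
set p := - evec k + _; set n := - evec k - _.
move=> gz; suff -> : M' p + M' n = z by [].
have uk : M' (evec k) \is a GRing.unit.
  exact: (frame_unit (framed_skew FM) (framed_rel FM)).
apply: (mulrI uk).
apply: (graph_fun (x := X' (evec k) * (X' p + X' n))); last first.
  by rewrite -(framed_evec FX) -(framed_evec FM); apply: graphM (g k) gz.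
(* After multiplication by [v_k] the exponents become the positive part of column [k] and minus its
   negative part. Both are nonnegative, so [graph_frame] applies to the current cluster. *)
have mono h : (forall i, 0 <= (evec k + h) i 0) ->
    graph (X' (evec k) * X' h, M' (evec k) * M' h).
  move=> h0; have [_ ->] := framed_rel FX; have [_ ->] := framed_rel FM.
  rewrite -EL; apply: (graphM (graph_Xz _)).
  rewrite -(framed_of ct ut _ FX) -(framed_of ce ue _ FM) EL.
  exact: graph_frame.
rewrite !mulrDr; apply: (lspanD (mono p _) (mono n _)) => j.
  by rewrite /p addrA subrr add0r mxE le_max lexx orbT.
by rewrite /n addrA subrr add0r !mxE oppr_ge0 ge_min lexx orbT.
Qed.

End Mutations.

(** * Mixed tori and the kernel of specialization *)

Section MixedTorus.
Variables (ex inv : {set 'I_N}).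
Let Tq := mixedTorus (fun x => x = t \/ x = t^-1) ex inv X.

Definition mixed_cone (f : vec) : Prop :=
  forall i, i \notin ex -> i \notin inv -> 0 <= f i 0.

(** The generators have exponents in the cone, and the cone is closed under addition. Working in the
    product ring yields an image of [x] at the same time. *)
Lemma mixedTorus_graph x : Tq x -> exists y, lspan te XM mixed_cone (x, y).
Proof.
have [X0 _] := frX; have [M0 _] := frM.
have sz n : lspan te XM mixed_cone (t ^ n, e ^ n).
  have := @lspan_term _ _ te XM mixed_cone (te ^ n) 0 (lcoefXz te n).
  rewrite pairXz /XM X0 M0 -[_ * _]/(t ^ n * 1, e ^ n * 1) !mulr1; apply.
  by move=> i _ _; rewrite mxE.
elim=> {x} [x|||x _ [y gy]|].
- move=> [[->|->]|[[i ->]|[j [jex ->]]]].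
  + by exists e; apply: (sz 1).
  + by exists e^-1; apply: (sz (-1)).
  + exists (M (evec i)); apply: (@lspan_gen _ _ te XM) => j _ _.
    by rewrite evecE ler0n.
  + exists (M (- evec j)); rewrite -(frameN skewL frX).
    apply: (@lspan_gen _ _ te XM) => i iex iinv; rewrite mxE evecE.
    by have [ij|] := eqVneq i j; rewrite ?oppr0 // -ij (negPf iex) (negPf iinv) in jex.
- by exists 1; apply: (sz 0).
- by move=> x x' _ [y gy] _ [y' gy']; exists (y + y'); apply: (lspanD gy gy').
- by exists (- y); apply: (lspanN cte ute gy).
- move=> x x' _ [y gy] _ [y' gy']; exists (y * y').
  apply: (lspanM cte ute frXM _ gy gy') => f g cf cg i iex iinv.
  by rewrite mxE addr_ge0 ?cf ?cg.
Qed.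

Lemma mixedTorus_monomial f : mixed_cone f -> Tq (X f).
Proof.
move=> cf; rewrite -(frame_ofE ct ut skewL frX).
have tT : Tq t by apply: sg_base; left; left.
have tVT : Tq t^-1 by apply: sg_base; left; right.
apply: sg_mul.
  case: (intP (- _)) => [|n|n]; [exact: sg_one|exact: subring_gen_Xn|].
  by rewrite -exprnN -exprVn; apply: subring_gen_Xn.
apply: (big_ind Tq); [exact: sg_one|exact: sg_mul|move=> i _].
have XiT : Tq (X (evec i)) by apply: sg_base; right; left; exists i.
have := cf i; case: (intP (f i 0)) => [|n|n] cfi; first exact: sg_one.
  exact: subring_gen_Xn.
rewrite -exprnN -exprVn; apply/subring_gen_Xn/sg_base; right; right; exists i.
split=> //; apply/negPn/negP; rewrite negb_or => /andP[iex iinv].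
by have := cfi iex iinv.
Qed.

(* If the image of x vanishes, every coefficient of x is a polynomial in t (up
   to a power of t) that vanishes at e. *)
Lemma mixedTorus_ker (Phi : {poly int}) x : indep e M ->
    (forall p, pev p e = 0 -> exists q, p = Phi * q) ->
    Tq x -> kap x 0 -> exists z, Tq z /\ x = pev Phi t * z.
Proof.
move=> indM PhiP Tx /kappaP gx0; have [y gy] := mixedTorus_graph Tx.
(* The expansion with exponents in the cone need not be the one witnessing [kap x 0];
   single-valuedness shows that its image is zero as well. *)
have y0 : y = 0 by apply: graph_fun gx0; apply: lspanW gy.
rewrite {y}y0 in gy; have [S [c [uS cc cS E]]] := lspan_rep cte ute gy.
have E2 : \sum_(f <- S) (c f).2 * M f = 0.
  by have := congr1 snd E; rewrite raddf_sum => <-.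
have c20 : forall f, f \in S -> (c f).2 = 0.
  apply: indM E2 => // f.
  by have [p [k ->]] := cc f; rewrite pair_pev pairVn; exists p, k.
have -> : x = \sum_(f <- S) (c f).1 * X f.
  by have := congr1 fst E; rewrite raddf_sum => <-.
elim: (S) cS c20 => [|f r IHr] cS c20.
  exists 0; rewrite big_nil mulr0; split=> //.
  by rewrite -(subrr 1); apply: sg_add (sg_one _) (sg_opp (sg_one _)).
rewrite big_cons; have [| |z [Tz ->]] := IHr.
- by move=> g gr; apply: cS; rewrite inE gr orbT.
- by move=> g gr; apply: c20; rewrite inE gr orbT.
have := c20 f (mem_head _ _); have [p [k ->]] := cc f.
rewrite pair_pev pairVn /= => pe0.
have [q ->] : exists q, p = Phi * q.
  apply: PhiP; apply: (mulIr (_ : e ^- k \is a GRing.unit)).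
    by rewrite unitrV unitrX.
  by rewrite mul0r.
exists (pev q t * t ^- k * X f + z); rewrite mulrDr pevM !mulrA; split=> //.
have tT : Tq t by apply: sg_base; left; left.
have tVT : Tq t^-1 by apply: sg_base; left; right.
apply: sg_add Tz; apply: sg_mul; last by apply/mixedTorus_monomial/cS/mem_head.
by apply: sg_mul; [apply: subring_gen_pev | rewrite -exprVn; apply: subring_gen_Xn].
Qed.

End MixedTorus.

End Specialization.

Unset Implicit Arguments.

(** * Specialization of the quantum cluster algebra *)

Theorem theorem5p9 (ell N : nat) (ex inv : {set 'I_N})
  (Btil L : 'M[int]_N) (d : 'I_N -> int)
  (D : unitRingType) (t : D) (X : 'cV[int]_N -> D)
  (F : unitRingType) (e : F) (M : 'cV[int]_N -> F) :
  (0 < ell)%N ->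
  (* F is a division algebra over Q(eps^{1/2}), eps^{1/2} |-> e *)
  is_divring F ->
  (forall n : nat, (0 < n)%N -> n%:R != 0 :> F) ->
  (forall x : F, e * x = x * e) ->
  pev 'Phi_ell e = 0 ->
  (* D = Fract(T_q(L)), q^{1/2} |-> t, X = M_q *)
  is_divring D ->
  (forall x : D, t * x = x * t) ->
  q_toric_frame t L X ->
  (* data of the seed *)
  L^T = - L ->
  (forall j, j \in ex -> 0 < d j) ->
  (forall i j, i \in ex -> j \in ex -> d i * Btil i j = - (d j * Btil j i)) ->
  (forall i j, j \in ex -> \sum_(k < N) Btil k j * L k i = (i == j)%:R * d j) ->
  (* M is a root of unity toric frame with Lambda_M = L mod ell (strictness) *)
  ru_toric_frame e L M ->
  [disjoint inv & ex] ->
  let Aq := clusterAlg (fun x => x = t \/ x = t^-1) t ex inv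
              (Seed L Btil (fun i => X (evec i))) in
  let Ae := clusterAlg (fun y => y = e) e ex inv
              (Seed L Btil (fun i => M (evec i))) in
  let Tq := mixedTorus (fun x => x = t \/ x = t^-1) ex inv X in
  let Phi := pev 'Phi_ell t in
  (forall x, (Aq x /\ exists z, Tq z /\ x = Phi * z) <->
             (exists z, Aq z /\ x = Phi * z)) ->
  (forall x, Aq x -> (exists y, kappa t X e M x y) /\
                     forall y, kappa t X e M x y -> Ae y) /\
  (forall y, Ae y -> exists x, Aq x /\ kappa t X e M x y) /\
  (forall x, Aq x -> (kappa t X e M x 0 <-> exists z, Aq z /\ x = Phi * z)).
Proof.
move=> l0 divF char0 ce Phie divD ct tfX skewL d_gt0 _ cBL tfM _ Aq Ae Tq Phi H.
have el := Cyclotomic_root_expr1 l0 Phie.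
have ue : e \is a GRing.unit by rewrite -(unitrX_pos _ l0) el unitr1.
have transc p : pev p t = 0 -> p = 0 by apply: q_toric_frame_root tfX.
have t0 : t != 0.
  apply/eqP => t0; have := transc 'X^1; rewrite pevXn expr1 => /(_ t0)/eqP.
  by rewrite expr1 polyX_eq0.
have ut := divD _ t0.
have Phi0 : Phi != 0.
  by apply/eqP => /transc/eqP; apply/negP/monic_neq0/Cyclotomic_monic.
have [frX frM] := (proj1 tfX, proj1 tfM).
have indX := q_toric_frame_indep tfX.
have indM := ru_toric_frame_indep l0 el tfM.
have cLB := compatibleP cBL.
have AqT x : Aq x -> Tq x.
  move=> Ax; have [|_ [z [Tz /(mulrI (divD _ Phi0)) ->]]] // := (H (Phi * x)).2.
  by exists x.
pose kap := kappa t X e M.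
have kapP x y : kap x y <-> _ := kappaP ut ue X M x y.
have kapD := kappaD ut ue (X := X) (M := M).
have kapN := kappaN ct ut ce ue (X := X) (M := M).
have kapM := kappaM ct ut ce ue frX frM.
have kapXz := kappa_Xz ut ue frX frM.
have AqK x : Aq x -> exists y, kap x y.
  move=> /AqT/(mixedTorus_graph ct ut ce ue skewL frX frM)[y gy].
  by exists y; apply/kapP; apply: lspanW gy.
have cv ks i : all (fun k => k \in ex) ks ->
    kap (sv (mut_seq t ks (Seed L Btil (fun i => X (evec i)))) i)
          (sv (mut_seq e ks (Seed L Btil (fun i => M (evec i)))) i).
  move=> ksex; apply: (kappa_mut_seq ct ut ce ue skewL frX frM indX transc divD divF
    d_gt0 cLB indM _ ksex).
  by move=> x xcv; apply/AqK/sg_base; right; left.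
have kappa_inv j : kap (X (evec j))^-1 (M (evec j))^-1.
  rewrite -(frameN skewL frX) -(frameN skewL frM); exact: kappa_frame.
(* The scalars of [Ae] are generated by [e] alone, whereas [Aq] contains [t^-1]; its image is a
   power of [e] because [e ^+ ell = 1]. *)
have AeVe : Ae e^-1.
  have -> : e^-1 = e ^+ ell.-1.
    by apply: (mulrI ue); rewrite divrr // -exprS prednK.
  by apply/subring_gen_Xn/sg_base; left.
have AqG x : Aq x -> exists y, kap x y /\ Ae y.
  elim=> {x} [x|||x _ [y [g Ay]]|].
  - move=> [[->|->]|[[ks [ksex [i ->]]]|[j [jinv ->]]]].
    + by exists e; split; [apply: (kapXz 1) | apply: sg_base; left].
    + by exists e^-1; split; [apply: (kapXz (-1)) | ].
    + exists (sv (mut_seq e ks (Seed L Btil (fun i => M (evec i)))) i).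
      by split; [apply: cv | apply: sg_base; right; left; exists ks; split => //; exists i].
    + exists (M (evec j))^-1; split; first exact: kappa_inv.
      by apply: sg_base; right; right; exists j.
  - by exists 1; split; [apply: (kapXz 0) | apply: sg_one].
  - move=> x x' _ [y [g Ay]] _ [y' [g' Ay']]; exists (y + y').
    by split; [apply: kapD | apply: sg_add].
  - by exists (- y); split; [apply: kapN | apply: sg_opp].
  - move=> x x' _ [y [g Ay]] _ [y' [g' Ay']]; exists (y * y').
    by split; [apply: kapM | apply: sg_mul].
split=> [x Ax|].
  have [y [g Ay]] := AqG x Ax; split; first by exists y.
  by move=> z /(kappa_fun ct ut ce ue indX transc g) <-.
split=> [y|x Ax].
  elim=> {y} [y|||y _ [x [Ax g]]|].
  - move=> [->|[[ks [ksex [i ->]]]|[j [jinv ->]]]].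
    + by exists t; split; [apply: sg_base; left; left | apply: (kapXz 1)].
    + exists (sv (mut_seq t ks (Seed L Btil (fun i => X (evec i)))) i).
      by split; [apply: sg_base; right; left; exists ks; split => //; exists i | apply: cv].
    + exists (X (evec j))^-1; split; last exact: kappa_inv.
      by apply: sg_base; right; right; exists j.
  - by exists 1; split; [apply: sg_one | apply: (kapXz 0)].
  - move=> y y' _ [x [Ax g]] _ [x' [Ax' g']]; exists (x + x').
    by split; [apply: sg_add | apply: kapD].
  - by exists (- x); split; [apply: sg_opp | apply: kapN].
  - move=> y y' _ [x [Ax g]] _ [x' [Ax' g']]; exists (x * x').
    by split; [apply: sg_mul | apply: kapM].
split=> [gx|[z [Az ->]]].
  (* By the hypothesis it suffices to find [x] in [Phi * Tq], which is the kernel computation in the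
     mixed torus. *)
  apply/H; split=> //.
  apply: (mixedTorus_ker ct ut ce ue skewL frX frM indX transc (inv := inv) indM) => //.
  - by move=> p; apply: Cyclotomic_dvd_of_root.
  - exact: AqT.
have [y [g _]] := AqG z Az; rewrite -(mul0r y) -Phie; apply: kapM => //.
exact: (kappa_pev ut ue frX frM).
Qed.
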